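(* Let $T$ be a positive integer and let $nr^1,\dots,nr^T\in\mathbb{R}^{N}$ be finitely many vectors (cross-zonal exchanges), each satisfying $\sum_{z\in N} nr^i_z=0$. For each $i\in\{1,\dots,T\}$ let $(W^i_k)_{k\in CNE}$ be Secure Cross-zonal Capacities for $nr^i$. Suppose $nr\in\mathbb{R}^{N}$ and $f=(f_1,\dots,f_T)\in\mathbb{R}^T$ satisfy $$nr=\sum_{i=1}^T f_i\, nr^i,\qquad \sum_{i=1}^T W^i_k f_i\le \widetilde F_k\ \ \forall k\in CNE,\qquad f\ge 0.$$ Then $nr\in \mathrm{Proj}_{nr}(XSP)$.
   Context: $N$ is a finite set of zones, $CNE$ a finite set of critical network elements, $PTDF_{k,z}\in\mathbb{R}$ ($k\in CNE$, $z\in N$) and $\widetilde F_k\in\mathbb{R}$ ($k\in CNE$) are given parameters. For a capacity vector $(\widetilde F_k)_{k\in CNE}$, $XSP$ is the set of all tuples consisting of first-stage variables $(nr_z,TRD_z,TRS_z)_{z\in N}$ and, for each scenario $s=(s_z)_{z\in N}\in\{0,1\}^{N}$, second-stage variables $(TRDAct_{z,s},TRSAct_{z,s},nrAct_{z,s})_{z\in N}$, all real, such that: (1) $\sum_{z} nr_z=0$; (2) $\sum_{z} PTDF_{k,z}\,nr_z\le \widetilde F_k$ for all $k\in CNE$; (3) $nr_z=TRS_z-TRD_z$ for all $z\in N$; and for every scenario $s\in\{0,1\}^{N}$: (4) $TRDAct_{z,s}=s_z\,TRD_z$ for all $z$; (5) $TRSAct_{z,s}\le TRS_z$ for all $z$;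 (6) $nrAct_{z,s}=TRSAct_{z,s}-TRDAct_{z,s}$ for all $z$; (7) $\sum_z nrAct_{z,s}=0$; (8) $\sum_z PTDF_{k,z}\,nrAct_{z,s}\le \widetilde F_k$ for all $k\in CNE$; (9) $TRS,TRD,TRSAct,TRDAct\ge 0$. $\mathrm{Proj}_{nr}(XSP)$ is the projection of $XSP$ on the variables $nr=(nr_z)_{z\in N}$. For real parameters $W=(W_k)_{k\in CNE}$, $XSP[F\to W]$ denotes the set obtained from $XSP$ by replacing $\widetilde F_k$ by $W_k$ for every $k\in CNE$ in (2) and (8). Given a vector $nr\in\mathbb{R}^N$ with $\sum_z nr_z=0$, the parameters $(W_k)_{k\in CNE}$ are called Secure Cross-zonal Capacities for $nr$ if $nr\in \mathrm{Proj}_{nr}(XSP[F\to W])$. *)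

(* Defs.v *)
From mathcomp Require Import all_boot all_order all_algebra.
From mathcomp Require Import classical_sets reals.

Set Implicit Arguments.
Unset Strict Implicit.
Unset Printing Implicit Defensive.

Import Order.TTheory GRing.Theory Num.Theory.
Local Open Scope ring_scope.
Local Open Scope classical_set_scope.

(* A scenario is an element of {0,1}^N; the booleans false and true stand for
   0 and 1 and are cast to reals by [(s z)%:R]. *)
Definition scenario (N : finType) := {ffun N -> bool}.

Record xsp_vars (R : realType) (N : finType) := XspVars {
  nr : N -> R;
  TRD : N -> R;
  TRS : N -> R;
  TRDAct : N -> scenario N -> R;
  TRSAct : N -> scenario N -> R;
  nrAct : N -> scenario N -> R
}.

Record first_stage (R : realType) (N CNE : finType) (PTDF : CNE -> N -> R)
    (F : CNE -> R) (x : xsp_vars R N) : Prop := FirstStage {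
  nr_balance : \sum_(z : N) nr x z = 0;
  nr_capacity : forall k : CNE, \sum_(z : N) PTDF k z * nr x z <= F k;
  nr_def : forall z : N, nr x z = TRS x z - TRD x z;
  TRS_ge0 : forall z : N, 0 <= TRS x z;
  TRD_ge0 : forall z : N, 0 <= TRD x z
}.

Record second_stage (R : realType) (N CNE : finType) (PTDF : CNE -> N -> R)
    (F : CNE -> R) (x : xsp_vars R N) (s : scenario N) : Prop := SecondStage {
  TRDAct_def : forall z : N, TRDAct x z s = (s z)%:R * TRD x z;
  TRSAct_le : forall z : N, TRSAct x z s <= TRS x z;
  nrAct_def : forall z : N, nrAct x z s = TRSAct x z s - TRDAct x z s;
  nrAct_balance : \sum_(z : N) nrAct x z s = 0;
  nrAct_capacity : forall k : CNE, \sum_(z : N) PTDF k z * nrAct x z s <= F k;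
  TRSAct_ge0 : forall z : N, 0 <= TRSAct x z s;
  TRDAct_ge0 : forall z : N, 0 <= TRDAct x z s
}.

(* The substitution XSP[F -> W] is [XSP PTDF W]. *)
Definition XSP (R : realType) (N CNE : finType) (PTDF : CNE -> N -> R)
    (F : CNE -> R) : set (xsp_vars R N) :=
  [set x | first_stage PTDF F x /\ forall s : scenario N, second_stage PTDF F x s].

Definition Proj_nr (R : realType) (N : finType) (S : set (xsp_vars R N)) :
    set (N -> R) :=
  [set nr x | x in S].

(* Only used for exchanges [v] that sum to 0. *)
Definition secure_capacities (R : realType) (N CNE : finType)
    (PTDF : CNE -> N -> R) (v : N -> R) (W : CNE -> R) : Prop :=
  Proj_nr (XSP PTDF W) v.

(* Main.v *)
Require Import Defs.
From mathcomp Require Import all_boot all_order all_algebra.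
From mathcomp Require Import boolp classical_sets reals.

Set Implicit Arguments.
Unset Strict Implicit.
Unset Printing Implicit Defensive.

Import Order.TTheory GRing.Theory Num.Theory.
Local Open Scope ring_scope.

(** Once the binary scenario [s] is fixed, every constraint of XSP is linear and
    homogeneous jointly in the variables and the capacities, so the pairs
    (capacities, point of XSP for these capacities) form a convex cone; enlarging
    the capacities preserves feasibility.  Each [nrs i] lifts to a point [x i] of
    XSP for the capacities [W i].  The combination of the [x i] with the
    nonnegative weights [f i] then lies in XSP for the capacities
    [\sum_i W i k * f i], hence for [F], and its [nr] component is [v]. *)

Section ConicCombination.

Variables (R : realType) (I : finType) (f : I -> R).

Definition conic_comb (g : I -> R) : R := \sum_i f i * g i.

Lemma conic_comb_ge0 (g : I -> R) :
  (forall i, 0 <= f i) -> (forall i, 0 <= g i) -> 0 <= conic_comb g.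
Proof. by move=> hf hg; apply: sumr_ge0 => i _; apply: mulr_ge0. Qed.

Lemma ler_conic_comb (g h : I -> R) :
  (forall i, 0 <= f i) -> (forall i, g i <= h i) ->
  conic_comb g <= conic_comb h.
Proof. by move=> hf hgh; apply: ler_sum => i _; apply: ler_wpM2l. Qed.

Lemma conic_combB (g h : I -> R) :
  conic_comb g - conic_comb h = conic_comb (fun i => g i - h i).
Proof. by rewrite -sumrB; apply: eq_bigr => i _; rewrite mulrBr. Qed.

Lemma conic_combZ (a : R) (g : I -> R) :
  a * conic_comb g = conic_comb (fun i => a * g i).
Proof. by rewrite mulr_sumr; apply: eq_bigr => i _; rewrite mulrCA. Qed.

Lemma eq_conic_comb (g h : I -> R) : g =1 h -> conic_comb g = conic_comb h.
Proof. by move=> gh; apply: eq_bigr => i _; rewrite gh. Qed.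

Lemma conic_comb0 (g : I -> R) : (forall i, g i = 0) -> conic_comb g = 0.
Proof. by move=> g0; apply: big1 => i _; rewrite g0 mulr0. Qed.

Variable N : finType.

Lemma sum_conic_comb (g : I -> N -> R) :
  \sum_z conic_comb (g^~ z) = conic_comb (fun i => \sum_z g i z).
Proof. by rewrite exchange_big; apply: eq_bigr => i _; rewrite mulr_sumr. Qed.

Lemma dot_conic_comb (a : N -> R) (g : I -> N -> R) :
  \sum_z a z * conic_comb (g^~ z) = conic_comb (fun i => \sum_z a z * g i z).
Proof.
by rewrite -sum_conic_comb; apply: eq_bigr => z _; rewrite conic_combZ.
Qed.

Definition conic_comb_vars (x : I -> xsp_vars R N) : xsp_vars R N := {|
  nr z := conic_comb (fun i => nr (x i) z);
  TRD z := conic_comb (fun i => TRD (x i) z);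
  TRS z := conic_comb (fun i => TRS (x i) z);
  TRDAct z s := conic_comb (fun i => TRDAct (x i) z s);
  TRSAct z s := conic_comb (fun i => TRSAct (x i) z s);
  nrAct z s := conic_comb (fun i => nrAct (x i) z s)
|}.

Variables (CNE : finType) (PTDF : CNE -> N -> R).
Variables (W : I -> CNE -> R) (F : CNE -> R).
Hypothesis f_ge0 : forall i, 0 <= f i.
Hypothesis W_le_F : forall k, conic_comb (W^~ k) <= F k.

Lemma first_stage_conic_comb (x : I -> xsp_vars R N) :
  (forall i, first_stage PTDF (W i) (x i)) ->
  first_stage PTDF F (conic_comb_vars x).
Proof.
move=> hx; split=> /=.
- rewrite sum_conic_comb; apply: conic_comb0 => i.
  exact: nr_balance (hx i).
- move=> k; apply: le_trans (W_le_F k); rewrite dot_conic_comb.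
  by apply: ler_conic_comb => // i; exact: nr_capacity (hx i) k.
- move=> z; rewrite conic_combB; apply: eq_conic_comb => i.
  exact: nr_def (hx i) z.
- by move=> z; apply: conic_comb_ge0 => // i; exact: TRS_ge0 (hx i) z.
- by move=> z; apply: conic_comb_ge0 => // i; exact: TRD_ge0 (hx i) z.
Qed.

(** The coefficient [s z] multiplying [TRD] is a constant because all points are
    combined within one and the same scenario. *)
Lemma second_stage_conic_comb (x : I -> xsp_vars R N) (s : scenario N) :
  (forall i, second_stage PTDF (W i) (x i) s) ->
  second_stage PTDF F (conic_comb_vars x) s.
Proof.
move=> hx; split=> /=.
- move=> z; rewrite conic_combZ; apply: eq_conic_comb => i.
  exact: TRDAct_def (hx i) z.
- by move=> z; apply: ler_conic_comb => // i; exact: TRSAct_le (hx i) z.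
- move=> z; rewrite conic_combB; apply: eq_conic_comb => i.
  exact: nrAct_def (hx i) z.
- rewrite (sum_conic_comb (fun i z => nrAct (x i) z s)).
  by apply: conic_comb0 => i; exact: nrAct_balance (hx i).
- move=> k; apply: le_trans (W_le_F k).
  rewrite (dot_conic_comb (PTDF k) (fun i z => nrAct (x i) z s)).
  by apply: ler_conic_comb => // i; exact: nrAct_capacity (hx i) k.
- by move=> z; apply: conic_comb_ge0 => // i; exact: TRSAct_ge0 (hx i) z.
- by move=> z; apply: conic_comb_ge0 => // i; exact: TRDAct_ge0 (hx i) z.
Qed.

Lemma XSP_conic_comb (x : I -> xsp_vars R N) :
  (forall i, XSP PTDF (W i) (x i)) -> XSP PTDF F (conic_comb_vars x).
Proof.
move=> hx; split=> [|s].
  by apply: first_stage_conic_comb => i; case: (hx i).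
by apply: second_stage_conic_comb => i; case: (hx i).
Qed.

End ConicCombination.

Theorem theorem1 (R : realType) (N CNE : finType) (PTDF : CNE -> N -> R)
    (F : CNE -> R) (T : nat) (hT : (0 < T)%N)
    (nrs : 'I_T -> N -> R) (W : 'I_T -> CNE -> R)
    (hnrs : forall i : 'I_T, \sum_(z : N) nrs i z = 0)
    (hW : forall i : 'I_T, secure_capacities PTDF (nrs i) (W i))
    (v : N -> R) (f : 'I_T -> R)
    (hv : forall z : N, v z = \sum_(i < T) f i * nrs i z)
    (hcap : forall k : CNE, \sum_(i < T) W i k * f i <= F k)
    (hf : forall i : 'I_T, 0 <= f i) :
  Proj_nr (XSP PTDF F) v.
Proof.
have [x hx] : exists x : 'I_T -> xsp_vars R N,
    forall i, XSP PTDF (W i) (x i) /\ nr (x i) = nrs i.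
  apply: (@fin_all_exists _ (fun=> xsp_vars R N)
    (fun i y => XSP PTDF (W i) y /\ nr y = nrs i)) => i.
  by have [y hy yE] := hW i; exists y.
exists (conic_comb_vars f x).
  apply: (@XSP_conic_comb _ _ _ _ _ _ W) => // [k|i]; last by case: (hx i).
  apply: le_trans (hcap k).
  by rewrite le_eqVlt; apply/orP; left; apply/eqP/eq_bigr => i _; rewrite mulrC.
apply/funext => z; rewrite hv /=; apply: eq_conic_comb => i.
by case: (hx i) => _ ->.
Qed.
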